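(* (i) The logic $\mathcal{G}_\square+\mathbf{T}_\square$ (in $\mathcal{L}_\square$) and the logic $\mathcal{G}_\Diamond+\mathbf{T}_\Diamond$ (in $\mathcal{L}_\Diamond$) are strongly complete, for countable theories, with respect to the class of reflexive GK-models. (ii) $\mathcal{G}_\square+\mathbf{4}_\square$ and $\mathcal{G}_\Diamond+\mathbf{4}_\Diamond$ are strongly complete, for countable theories, with respect to the class of transitive GK-models. (iii) $\mathcal{G}S4_\square:=\mathcal{G}_\square+\mathbf{T}_\square+\mathbf{4}_\square$ and $\mathcal{G}S4_\Diamond:=\mathcal{G}_\Diamond+\mathbf{T}_\Diamond+\mathbf{4}_\Diamond$ are strongly complete, for countable theories, with respect to the class of GK-models that are both reflexive and transitive. Here ''a logic $L$ in language $\mathcal{L}$ is strongly complete for countable theories with respect to a class $\mathcal{C}$'' means: for every countable $T\subseteq\mathcal{L}$ and every $\varphi\in\mathcal{L}$, $T\vdash_L\varphi$ if and only if $T\models_{\mathcal{C}}\varphi$.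
   Context: $\mathcal{L}_\square$ (resp. $\mathcal{L}_\Diamond$) is the set of formulas built from a set $Var$ of propositional variables using $\wedge,\to,\bot$ and $\square$ (resp. $\Diamond$), with $\neg\varphi:=\varphi\to\bot$, $\varphi\vee\psi:=((\varphi\to\psi)\to\psi)\wedge((\psi\to\varphi)\to\varphi)$, $\varphi\leftrightarrow\psi:=(\varphi\to\psi)\wedge(\psi\to\varphi)$. The Gödel calculus $\mathcal{G}$ has axiom schemes $(\varphi\to\psi)\to((\psi\to\chi)\to(\varphi\to\chi))$; $(\varphi\wedge\psi)\to\varphi$; $(\varphi\wedge\psi)\to(\psi\wedge\varphi)$; $(\varphi\to(\psi\to\chi))\leftrightarrow((\varphi\wedge\psi)\to\chi)$; $\varphi\to(\varphi\wedge\varphi)$; $((\varphi\to\psi)\to\chi)\to(((\psi\to\varphi)\to\chi)\to\chi)$; $\bot\to\varphi$; and Modus Ponens. $\mathcal{G}_\square$ adds to $\mathcal{G}$ the schemes $\square(\varphi\to\psi)\to(\square\varphi\to\square\psi)$, $\neg\neg\square\theta\to\square\neg\neg\theta$ and the rule ''from $\varphi$ infer $\square\varphi$''. $\mathcal{G}_\Diamond$ adds to $\mathcal{G}$ the schemes $\Diamond(\varphi\vee\psi)\to(\Diamond\varphi\vee\Diamond\psi)$, $\Diamond\neg\neg\varphi\to\neg\neg\Diamond\varphi$, $\neg\Diamond\bot$ and the rule ''from $\varphi\to\psi$ infer $\Diamond\varphi\to\Diamond\psi$''. Further axiom schemes: $\mathbf{T}_\square$: $\square\varphi\to\varphi$;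 $\mathbf{4}_\square$: $\square\varphi\to\square\square\varphi$; $\mathbf{T}_\Diamond$: $\varphi\to\Diamond\varphi$; $\mathbf{4}_\Diamond$: $\Diamond\Diamond\varphi\to\Diamond\varphi$; ''$L+A$'' denotes $L$ with the scheme $A$ added. For such a logic $L$, $T\vdash_L\varphi$ means derivability from assumptions $T$, where the modal rule is applied only to theorems (steps not depending on assumptions). Semantics: on $[0,1]$, $a\cdot b=\min\{a,b\}$, $a\Rightarrow b=1$ if $a\le b$ and $=b$ otherwise. A GK-model $\langle W,S,e\rangle$ has a nonempty set $W$, arbitrary $S:W\times W\to[0,1]$ and $e:W\times Var\to[0,1]$, extended by $e(x,\varphi\wedge\psi)=e(x,\varphi)\cdot e(x,\psi)$, $e(x,\varphi\to\psi)=e(x,\varphi)\Rightarrow e(x,\psi)$, $e(x,\bot)=0$, $e(x,\square\varphi)=\inf_{y\in W}\{Sxy\Rightarrow e(y,\varphi)\}$, $e(x,\Diamond\varphi)=\sup_{y\in W}\{Sxy\cdot e(y,\varphi)\}$. The model is reflexive if $Sxx=1$ for all $x$, and transitive if $\min\{Sxy,Syz\}\le Sxz$ for all $x,y,z$. For a class $\mathcal{C}$ of GK-models, $T\models_{\mathcal{C}}\varphi$ means: for every model in $\mathcal{C}$ and every world $x$, if $e(x,\psi)=1$ for all $\psi\in T$ then $e(x,\varphi)=1$. *)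

(* Defs.v *)
From mathcomp Require Import all_boot all_order all_algebra.
From mathcomp Require Import boolp classical_sets cardinality reals.

Set Implicit Arguments.
Unset Strict Implicit.
Unset Printing Implicit Defensive.

Import Order.TTheory GRing.Theory Num.Theory.

Local Open Scope classical_set_scope.
Local Open Scope ring_scope.

Inductive modality : Set := Box | Diamond.

(* [fml Var Box] and [fml Var Diamond] are the two one-modality languages:    *)
(* the parameter [m] fixes the reading of the single operator [Modal].        *)
Inductive fml (Var : Type) (m : modality) : Type :=
| Atom of Var
| Bot
| And of fml Var m & fml Var m
| Imp of fml Var m & fml Var m
| Modal of fml Var m.

Arguments Atom {Var m} _.
Arguments Bot {Var m}.
Arguments And {Var m} _ _.
Arguments Imp {Var m} _ _.
Arguments Modal {Var m} _.

Definition Neg Var m (p : fml Var m) := Imp p Bot.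
Definition Or Var m (p q : fml Var m) :=
  And (Imp (Imp p q) q) (Imp (Imp q p) p).
Definition Iff Var m (p q : fml Var m) := And (Imp p q) (Imp q p).

Declare Scope fml_scope.
Delimit Scope fml_scope with fml.
Bind Scope fml_scope with fml.

Notation "p && q" := (And p q) : fml_scope.
Notation "p || q" := (Or p q) : fml_scope.
Notation "p ==> q" := (Imp p q) : fml_scope.
Notation "~~ p" := (Neg p) : fml_scope.
Notation "p <==> q" := (Iff p q)
  (at level 95, no associativity) : fml_scope.
Notation "□ p" := (@Modal _ Box p)
  (at level 35, right associativity) : fml_scope.
Notation "◇ p" := (@Modal _ Diamond p)
  (at level 35, right associativity) : fml_scope.

Inductive godel_axiom Var m : fml Var m -> Prop :=
| godel_trans p q r :
    godel_axiom ((p ==> q) ==> ((q ==> r) ==> (p ==> r)))%fml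
| godel_andl p q : godel_axiom ((p && q) ==> p)%fml
| godel_andC p q : godel_axiom ((p && q) ==> (q && p))%fml
| godel_curry p q r :
    godel_axiom ((p ==> (q ==> r)) <==> ((p && q) ==> r))%fml
| godel_contr p : godel_axiom (p ==> (p && p))%fml
| godel_prelin p q r :
    godel_axiom (((p ==> q) ==> r) ==> (((q ==> p) ==> r) ==> r))%fml
| godel_exfalso p : godel_axiom (Bot ==> p)%fml.

Inductive box_axiom Var : fml Var Box -> Prop :=
| box_K p q : box_axiom (□ (p ==> q) ==> (□ p ==> □ q))%fml
| box_Z p : box_axiom (~~ ~~ □ p ==> □ ~~ ~~ p)%fml.

Inductive box_rule Var : fml Var Box -> fml Var Box -> Prop :=
| box_nec p : box_rule p (□ p)%fml.

Inductive diamond_axiom Var : fml Var Diamond -> Prop :=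
| diamond_D p q : diamond_axiom (◇ (p || q) ==> (◇ p || ◇ q))%fml
| diamond_Z p : diamond_axiom (◇ ~~ ~~ p ==> ~~ ~~ ◇ p)%fml
| diamond_F : diamond_axiom (~~ ◇ Bot)%fml.

Inductive diamond_rule Var : fml Var Diamond -> fml Var Diamond -> Prop :=
| diamond_mono p q : diamond_rule (p ==> q)%fml (◇ p ==> ◇ q)%fml.

Inductive T_box Var : fml Var Box -> Prop :=
| T_box_ax p : T_box (□ p ==> p)%fml.

Inductive Four_box Var : fml Var Box -> Prop :=
| Four_box_ax p : Four_box (□ p ==> □ □ p)%fml.

Inductive T_diamond Var : fml Var Diamond -> Prop :=
| T_diamond_ax p : T_diamond (p ==> ◇ p)%fml.

Inductive Four_diamond Var : fml Var Diamond -> Prop :=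
| Four_diamond_ax p : Four_diamond (◇ ◇ p ==> ◇ p)%fml.

(* [logic_rule L p q] means that [q] may be inferred from the theorem [p].    *)
Record logic (Var : Type) (m : modality) := Logic {
  logic_axiom : set (fml Var m) ;
  logic_rule : fml Var m -> fml Var m -> Prop }.

Definition G_box Var : logic Var Box :=
  Logic (@godel_axiom Var Box `|` @box_axiom Var) (@box_rule Var).

Definition G_diamond Var : logic Var Diamond :=
  Logic (@godel_axiom Var Diamond `|` @diamond_axiom Var) (@diamond_rule Var).

Definition add_scheme Var m (L : logic Var m) (A : set (fml Var m)) :=
  Logic (logic_axiom L `|` A) (logic_rule L).

Definition GS4_box Var := add_scheme (add_scheme (G_box Var) (@T_box Var))
  (@Four_box Var).

Definition GS4_diamond Var :=
  add_scheme (add_scheme (G_diamond Var) (@T_diamond Var)) (@Four_diamond Var).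

(* The assumptions are an index because the premise of the modal rule has to  *)
(* be a theorem, i.e. derivable from no assumptions.                          *)
Inductive derives Var m (L : logic Var m) :
    set (fml Var m) -> fml Var m -> Prop :=
| derives_hyp (T : set (fml Var m)) p : T p -> derives L T p
| derives_axiom (T : set (fml Var m)) p : logic_axiom L p -> derives L T p
| derives_mp (T : set (fml Var m)) p q :
    derives L T p -> derives L T (p ==> q)%fml -> derives L T q
| derives_modal (T : set (fml Var m)) p q :
    derives L set0 p -> logic_rule L p q -> derives L T q.

Record gk_model (R : realType) (Var : Type) := GKModel {
  world : Type ;
  acc : world -> world -> R ;
  valuation : world -> Var -> R ;
  world_inhabited : inhabited world ;
  acc_itv : forall x y, 0 <= acc x y <= 1 ;
  valuation_itv : forall x v, 0 <= valuation x v <= 1 }.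

Definition gimp (R : realType) (a b : R) : R := if a <= b then 1 else b.

(* The [inf] and [sup] below are over nonempty subsets of [0, 1], where they  *)
(* are the genuine bounds.                                                    *)
Fixpoint eval (R : realType) Var m (M : gk_model R Var) (x : world M)
    (p : fml Var m) {struct p} : R :=
  match p with
  | Atom v => valuation x v
  | Bot => 0
  | And p q => Num.min (eval x p) (eval x q)
  | Imp p q => gimp (eval x p) (eval x q)
  | Modal p =>
      match m with
      | Box => inf (range (fun y : world M => gimp (acc x y) (eval y p)))
      | Diamond => sup (range (fun y : world M => Num.min (acc x y) (eval y p)))
      end
  end.

Definition gk_reflexive (R : realType) Var (M : gk_model R Var) : Prop :=
  forall x : world M, acc x x = 1.

Definition gk_transitive (R : realType) Var (M : gk_model R Var) : Prop :=
  forall x y z : world M, Num.min (acc x y) (acc y z) <= acc x z.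

Definition entails (R : realType) Var m (C : gk_model R Var -> Prop)
    (T : set (fml Var m)) (p : fml Var m) : Prop :=
  forall M : gk_model R Var, C M -> forall x : world M,
    (forall q, T q -> eval x q = 1) -> eval x p = 1.

Definition strongly_complete (R : realType) Var m (L : logic Var m)
    (C : gk_model R Var -> Prop) : Prop :=
  forall (T : set (fml Var m)) (p : fml Var m),
    countable T -> (derives L T p <-> entails C T p).

(* Main.v *)
(* Soundness is routine.  For completeness, rename the countably many         *)
(* variables of [T] and [p] to natural numbers, so that the language becomes  *)
(* countable.  A theory maximal among those deriving no element of a directed *)
(* set [D] is linear by prelinearity; ordered by provable implication, the    *)
(* formulas form a countable chain, which embeds in [0, 1] with all values    *)
(* other than 0 and 1 in a prescribed interval ]a, b[.                        *)
(* The canonical worlds are the Gödel valuations [h] (modal formulas being    *)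
(* treated as atoms) that satisfy all theorems.                               *)
(* Box: take the crisp relation [v (□ q) <= w q for all q].  If               *)
(* [v (□ p) = a < 1], a witness [w] satisfies [q : v (□ q) > a], refutes [p], *)
(* and takes its intermediate values in ]a, a + e[; axiom Z makes [w] nonzero *)
(* wherever [v (□ q)] is.                                                     *)
(* Diamond: take [S v w = inf_q (w q => v (◇ q))].  If [v (◇ p) = a > 0], a   *)
(* witness [w] satisfies [p], refutes the ideal [q : v (◇ q) < a] (hence, by  *)
(* axiom Z, gives 0 to [q] whenever [v (◇ q) = 0]), and takes its             *)
(* intermediate values below all nonzero values of [v]; then [S v w >= a].    *)

Require Import Defs.
From mathcomp Require Import all_boot all_order all_algebra.
From mathcomp Require Import boolp classical_sets cardinality reals.
From mathcomp Require Import lra.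

Set Implicit Arguments.
Unset Strict Implicit.
Unset Printing Implicit Defensive.

Import Order.TTheory GRing.Theory Num.Theory.

Local Open Scope classical_set_scope.
Local Open Scope ring_scope.

(** Completeness comes from one canonical model per logic. Its worlds are the [0, 1]-valued maps on
    formulas that respect the connectives, treat modal formulas as atoms, send theorems to 1 and
    keep their nonzero values away from 0. The engine is [hom_extension]: a theory deriving no
    member of a directed set extends to a linear theory avoiding that set, and the resulting
    countable chain of formulas embeds in [0, 1] with all intermediate values in an interval chosen
    at will.

    This freedom yields the truth lemmas. For [Box], a successor takes its intermediate values just
    above the value of the boxed formula ([canonical_box_witness]); for [Diamond], below every
    nonzero value of the given world ([canonical_diamond_witness]). The schemes T and 4 say directly
    that the canonical relation is reflexive and transitive. Finally [strongly_complete_of_nat]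
    transfers countermodels from countably many variables to any type of variables. *)

(** * The Gödel algebra on [0, 1] and its valuations *)

Variant gimp_spec (R : realType) (a b : R) : R -> Prop :=
| GimpLe of a <= b : gimp_spec a b 1
| GimpGt of b < a : gimp_spec a b b.

Lemma gimpP (R : realType) (a b : R) : gimp_spec a b (gimp a b).
Proof. by rewrite /gimp; case: (leP a b); constructor. Qed.

Lemma gimp_itv (R : realType) (a b : R) : 0 <= b <= 1 -> 0 <= gimp a b <= 1.
Proof. by rewrite /gimp; case: ifP => // _ _; rewrite ler01 lexx. Qed.

Lemma gimp_eq1 (R : realType) (a b : R) : a <= 1 -> gimp a b = 1 <-> a <= b.
Proof.
move=> a1; rewrite /gimp; case: leP => // ba.
by split=> // b1; rewrite b1 in ba; lra.
Qed.

Lemma le_gimp (R : realType) (a b c : R) :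
  c <= 1 -> (c <= gimp a b) = (Num.min c a <= b).
Proof.
move=> c1; rewrite /gimp ge_min; case: (leP a b) => _; first by rewrite c1 orbT.
by rewrite orbF.
Qed.

Lemma gimp_refl (R : realType) (a : R) : gimp a a = 1.
Proof. by rewrite /gimp lexx. Qed.

Lemma gimp1l (R : realType) (b : R) : b <= 1 -> gimp 1 b = b.
Proof. by rewrite /gimp; case: (leP 1 b) => // b1 ?; apply: le_anti; rewrite b1. Qed.

Lemma ge_gimp (R : realType) (a b : R) : b <= 1 -> b <= gimp a b.
Proof. by rewrite /gimp; case: ifP. Qed.

(** No clause constrains [Modal]: modal formulas behave as extra atoms, so this is a purely
    propositional valuation. *)
Record godel_hom (R : realType) V m (h : fml V m -> R) : Prop := GodelHom {
  hom_itv : forall p, 0 <= h p <= 1 ;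
  hom_bot : h Bot = 0 ;
  hom_and : forall p q, h (p && q)%fml = Num.min (h p) (h q) ;
  hom_imp : forall p q, h (p ==> q)%fml = gimp (h p) (h q) }.

Lemma hom_le1 (R : realType) V m (h : fml V m -> R) p : godel_hom h -> h p <= 1.
Proof. by move=> /hom_itv /(_ p) /andP[]. Qed.

Lemma hom_ge0 (R : realType) V m (h : fml V m -> R) p : godel_hom h -> 0 <= h p.
Proof. by move=> /hom_itv /(_ p) /andP[]. Qed.

Lemma hom_imp1 (R : realType) V m (h : fml V m -> R) p q :
  godel_hom h -> h (p ==> q)%fml = 1 <-> h p <= h q.
Proof. by move=> hh; rewrite hom_imp //; apply: gimp_eq1; apply: hom_le1. Qed.

Lemma hom_or (R : realType) V m (h : fml V m -> R) p q :
  godel_hom h -> h (p || q)%fml = Num.max (h p) (h q).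
Proof.
move=> hh; have p1 := hom_le1 p hh; have q1 := hom_le1 q hh.
rewrite !(hom_and hh, hom_imp hh) {2 4}/gimp.
case: (ltgtP (h p) (h q)) => [pq|qp|->]; rewrite ?gimp_refl ?gimp1l //.
- by rewrite min_l.
- by rewrite min_r.
- by rewrite minxx.
Qed.

Lemma hom_neg (R : realType) V m (h : fml V m -> R) p :
  godel_hom h -> h (~~ p)%fml = if h p == 0 then 1 else 0.
Proof.
move=> hh; rewrite hom_imp // /gimp (hom_bot hh).
by rewrite (eq_le (h p)) hom_ge0 // andbT.
Qed.

(** Double negation only records whether a value vanishes; this is what the Z axioms transport
    across the modality. *)
Lemma hom_negneg (R : realType) V m (h : fml V m -> R) p :
  godel_hom h -> h (~~ ~~ p)%fml = if h p == 0 then 0 else 1.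
Proof.
move=> hh; rewrite !hom_neg //.
by case: (h p == 0); rewrite ?eqxx // oner_eq0.
Qed.

Lemma hom_godel_axiom (R : realType) V m (h : fml V m -> R) p :
  godel_hom h -> godel_axiom p -> h p = 1.
Proof.
move=> hh ax; have h01 q : 0 <= h q <= 1 by exact: hom_itv.
have h1 q : h q <= 1 by exact: hom_le1.
case: ax => [p1 p2 p3|p1 p2|p1 p2|p1 p2 p3|p1|p1 p2 p3|p1];
  rewrite /Iff !(hom_and hh, hom_imp hh, hom_bot hh);
  try move: (h p3) (h01 p3) (h1 p3) => c c01 c1;
  try move: (h p2) (h01 p2) => b b01; move: (h p1) (h01 p1) => a a01.
- by case: (gimpP a b); case: (gimpP b c); case: (gimpP a c) => *;
    rewrite ?gimp1l //; repeat (case: gimpP => ? //); lra.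
- by case: gimpP => //; rewrite lt_min ltxx.
- by rewrite minC gimp_refl.
- suff -> : gimp a (gimp b c) = gimp (Num.min a b) c by rewrite gimp_refl minxx.
  by case: (gimpP b c); repeat case: gimpP => //; rewrite ?(ge_min, lt_min); lra.
- by rewrite minxx gimp_refl.
- by case: (gimpP a b); case: (gimpP b a); case: (gimpP a c);
    case: (gimpP b c) => *; rewrite ?gimp1l ?gimp_refl ?gimp1l //;
    repeat (case: gimpP => ? //); lra.
- by rewrite /gimp; case/andP: a01 => ->.
Qed.

(** * Deduction theorem and linear extensions of theories *)

Section Calculus.
Context {V : Type} {m : modality} (L : logic V m).
Implicit Types (S T : set (fml V m)) (p q r : fml V m).

Lemma derives_cut S T p :
  (forall q, S q -> derives L T q) -> derives L S p -> derives L T p.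
Proof.
move=> ST d; elim: d T ST => {S p}.
- by move=> S p Sp T; apply.
- by move=> S p ax T _; exact: derives_axiom.
- by move=> S p q _ IHp _ IHq T ST; apply: derives_mp (IHp _ ST) (IHq _ ST).
- by move=> S p q dp _ r T _; exact: derives_modal r.
Qed.

Lemma derives_sub S T p : S `<=` T -> derives L S p -> derives L T p.
Proof. by move=> ST; apply: derives_cut => q /ST; apply: derives_hyp. Qed.

Lemma derives_theorem S p : derives L set0 p -> derives L S p.
Proof. by apply: derives_sub. Qed.

Hypothesis godelL : @godel_axiom V m `<=` logic_axiom L.

Lemma derives_godel S p : godel_axiom p -> derives L S p.
Proof. by move=> /godelL; exact: derives_axiom. Qed.

Lemma derives_trans S q p r :
  derives L S (p ==> q)%fml -> derives L S (q ==> r)%fml ->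
  derives L S (p ==> r)%fml.
Proof.
move=> pq qr; apply: derives_mp qr _; apply: derives_mp pq _.
exact/derives_godel/godel_trans.
Qed.

Lemma derives_andl S p q : derives L S (p && q ==> p)%fml.
Proof. exact/derives_godel/godel_andl. Qed.

Lemma derives_andC S p q : derives L S (p && q ==> q && p)%fml.
Proof. exact/derives_godel/godel_andC. Qed.

Lemma derives_andr S p q : derives L S (p && q ==> q)%fml.
Proof. exact: derives_trans (derives_andC _ _ _) (derives_andl _ _ _). Qed.

Lemma derives_curry S p q r :
  derives L S (p && q ==> r)%fml -> derives L S (p ==> (q ==> r))%fml.
Proof.
move=> d; apply: derives_mp d _; apply: derives_mp (derives_andr _ _ _).
exact/derives_godel/godel_curry.
Qed.

Lemma derives_uncurry S p q r :
  derives L S (p ==> (q ==> r))%fml -> derives L S (p && q ==> r)%fml.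
Proof.
move=> d; apply: derives_mp d _; apply: derives_mp (derives_andl _ _ _).
exact/derives_godel/godel_curry.
Qed.

Lemma derives_id S p : derives L S (p ==> p)%fml.
Proof.
exact: derives_trans (derives_godel _ (godel_contr p)) (derives_andl _ _ _).
Qed.

Lemma derives_K S p q : derives L S q -> derives L S (p ==> q)%fml.
Proof.
by move=> dq; apply: derives_mp dq _; apply: derives_curry; exact: derives_andl.
Qed.

Lemma derives_S S p q r : derives L S (p ==> q)%fml ->
  derives L S (p ==> (q ==> r))%fml -> derives L S (p ==> r)%fml.
Proof.
move=> pq pqr; apply: (derives_trans (derives_godel S (godel_contr p))).
apply/derives_uncurry/(derives_trans pq)/derives_curry.
exact: derives_trans (derives_andC _ _ _) (derives_uncurry pqr).
Qed.

(** The modal rule is harmless here: its premise is a theorem, so its conclusion is one too and can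
    be weakened. *)
Lemma deduction S p q : derives L (S `|` [set p]) q -> derives L S (p ==> q)%fml.
Proof.
suff gen T : derives L T q -> forall S, T = S `|` [set p] ->
    derives L S (p ==> q)%fml by move=> /gen; exact.
elim=> {S T q}.
- move=> T q Tq S TE; move: Tq; rewrite TE => -[Sq| ->]; last exact: derives_id.
  by apply: derives_K; exact: derives_hyp.
- by move=> T q ax S _; apply: derives_K; exact: derives_axiom.
- move=> T q r _ IHq _ IHr S TE.
  exact: derives_S (IHq _ TE) (IHr _ TE).
- by move=> T q r dq _ ru S _; apply: derives_K; exact: derives_modal ru.
Qed.

Lemma derives_prelin S p q r : derives L S ((p ==> q) ==> r)%fml ->
  derives L S ((q ==> p) ==> r)%fml -> derives L S r.
Proof.
move=> d1 d2; apply: derives_mp d2 _; apply: derives_mp d1 _.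
exact/derives_godel/godel_prelin.
Qed.

Lemma derives_chain (S : set (fml V m)) (F : set (set (fml V m))) p :
  total_on F subset -> derives L (S `|` \bigcup_(X in F) X) p ->
  derives L S p \/ exists2 X, F X & derives L (S `|` X) p.
Proof.
move=> Ftot; suff gen T : derives L T p ->
    forall S, T = S `|` \bigcup_(X in F) X ->
    derives L S p \/ exists2 X, F X & derives L (S `|` X) p.
  by move=> /gen; exact.
elim=> {S T p}.
- move=> T p Tp S TE; move: Tp; rewrite TE => -[Sp|[X FX Xp]].
    by left; exact: derives_hyp.
  by right; exists X => //; apply: derives_hyp; right.
- by move=> T q ax S _; left; exact: derives_axiom.
- have sub S X Y p : X `<=` Y -> derives L (S `|` X) p -> derives L (S `|` Y) p.
    by move=> XY; apply: derives_sub; exact: setUS.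
  have subl S X p : derives L S p -> derives L (S `|` X) p.
    by apply: derives_sub; exact: subsetUl.
  move=> T q r _ IHq _ IHr S TE.
  have [dq|[X FX dq]] := IHq _ TE; have [dr|[Y FY dr]] := IHr _ TE.
  + by left; exact: derives_mp dq dr.
  + by right; exists Y => //; apply: derives_mp (subl _ _ _ dq) dr.
  + by right; exists X => //; apply: derives_mp dq (subl _ _ _ dr).
  + have [XY|YX] := Ftot _ _ FX FY.
      by right; exists Y => //; apply: derives_mp (sub _ _ _ _ XY dq) dr.
    by right; exists X => //; apply: derives_mp dq (sub _ _ _ _ YX dr).
- by move=> T q r dq _ ru S _; left; exact: derives_modal ru.
Qed.

(** Zorn's lemma gives a maximal theory avoiding [D]. If it contained neither [p ==> q] nor
    [q ==> p], each of these would imply a member of [D]; a common upper bound in [D] would then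
    follow by prelinearity. *)
Lemma linear_extension (S D : set (fml V m)) :
    (forall d e, D d -> D e -> exists f, [/\ D f,
       derives L set0 (d ==> f)%fml & derives L set0 (e ==> f)%fml]) ->
    (forall d, D d -> ~ derives L S d) ->
  exists X : set (fml V m), [/\ S `<=` X, (forall p, derives L X p -> X p),
    (forall p q, X (p ==> q)%fml \/ X (q ==> p)%fml) &
    (forall d, D d -> ~ X d)].
Proof.
move=> Ddir SD.
(* Keeping [S] outside [X] makes the union of the empty chain satisfy [P]. *)
pose P (X : set (fml V m)) := forall d, D d -> ~ derives L (S `|` X) d.
have [F FP Ftot|A [PA Amax]] := @Zorn_bigcup _ P.
  move=> d Dd dd; have [/SD|[X FX dX]] := derives_chain Ftot dd; first exact.
  exact: FP _ FX _ Dd dX.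
exists [set p | derives L (S `|` A) p]; split => //=.
- by move=> p Sp; apply: derives_hyp; left.
- by move=> p; apply: derives_cut.
- move=> p q.
  have ext r : ~ derives L (S `|` A) r ->
      exists2 d, D d & derives L (S `|` A) (r ==> d)%fml.
    move=> nr; have : ~ P (A `|` [set r]).
      apply: Amax; split; first exact: subsetUl.
      by move=> /(_ r (or_intror erefl)) Ar; apply: nr; apply: derives_hyp; right.
    move=> /existsNP[d /not_implyP[Dd /contrapT dd]]; exists d => //.
    by apply: deduction; rewrite -setUA.
  apply: contrapT => /not_orP[/ext[d Dd dd] /ext[e De de]].
  have [f [Df df ef]] := Ddir _ _ Dd De.
  apply: (PA _ Df); apply: (derives_prelin (p := p) (q := q)).
    exact: derives_trans dd (derives_theorem _ df).
  exact: derives_trans de (derives_theorem _ ef).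
Qed.

End Calculus.

(** * Embedding a countable chain in the unit interval *)

Section BinaryMass.
Context (R : realType).
Implicit Types A B : set nat.

Definition binary_sum A N : R :=
  \sum_(i < N) (if `[< A i >] then 2^-1 ^+ i.+1 else 0).

(** The measure on the natural numbers giving the point [i] weight 2^-(i+1), with the series written
    as a supremum of partial sums. *)
Definition binary_mass A : R := sup (range (binary_sum A)).

Let weight_gt0 i : 0 < 2^-1 ^+ i.+1 :> R.
Proof. by rewrite exprn_gt0 // invr_gt0. Qed.

Lemma binary_sum_itv A N : 0 <= binary_sum A N <= 1.
Proof.
rewrite sumr_ge0 => [|i _]; last by case: ifP => // _; exact/ltW/weight_gt0.
(* The bound 1 alone is not inductive; the missing tail has to be carried along. *)
suff : binary_sum A N <= 1 - 2^-1 ^+ N.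
  have : 0 <= 2^-1 ^+ N :> R by rewrite exprn_ge0 // invr_ge0.
  by rewrite /binary_sum; lra.
elim: N => [|N IH]; first by rewrite /binary_sum big_ord0 expr0 subrr.
rewrite /binary_sum big_ord_recr /= -/(binary_sum A N).
have := weight_gt0 N; move: IH; rewrite exprS.
by case: ifP => _ ? ?; lra.
Qed.

Lemma binary_sum_le_mass A N : binary_sum A N <= binary_mass A.
Proof.
apply: ub_le_sup; last by exists N.
by exists 1 => _ [M _ <-]; case/andP: (binary_sum_itv A M).
Qed.

Lemma binary_mass_itv A : 0 <= binary_mass A <= 1.
Proof.
apply/andP; split.
  by apply: le_trans (binary_sum_le_mass A 0); case/andP: (binary_sum_itv A 0).
apply: ge_sup; first by exists (binary_sum A 0); exists 0%N.
by move=> _ [N _ <-]; case/andP: (binary_sum_itv A N).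
Qed.

Lemma binary_sum_mono A N M : (N <= M)%N -> binary_sum A N <= binary_sum A M.
Proof.
move=> /subnK <-; elim: (M - N)%N => [|d IH]; first by rewrite add0n.
apply: le_trans IH _; rewrite addSn /binary_sum big_ord_recr /= lerDl.
by case: ifP => // _; exact/ltW/weight_gt0.
Qed.

Lemma binary_mass_le A B : A `<=` B -> binary_mass A <= binary_mass B.
Proof.
move=> AB; apply: ge_sup; first by exists (binary_sum A 0); exists 0%N.
move=> _ [N _ <-]; apply: le_trans (binary_sum_le_mass B N).
apply: ler_sum => i _; case: asboolP => [/AB Bi|_]; first by rewrite asboolT.
by case: ifP => // _; exact/ltW/weight_gt0.
Qed.

Lemma binary_mass_lt A B k :
  A `<=` B -> B k -> ~ A k -> binary_mass A < binary_mass B.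
Proof.
move=> AB Bk nAk.
(* A strict inequality could vanish in the supremum, so a fixed gap, the weight of [k], is kept
   through all partial sums past [k]. *)
have step M : binary_sum A M + (if (k < M)%N then 2^-1 ^+ k.+1 else 0)
    <= binary_sum B M.
  elim: M => [|M IH]; first by rewrite /binary_sum !big_ord0 addr0.
  rewrite /binary_sum !big_ord_recr /= -/(binary_sum A M) -/(binary_sum B M).
  have w0 := weight_gt0 M; rewrite ltnS (leq_eqVlt k M).
  have [kM|kM] /= := eqVneq k M.
    by move: IH; rewrite -kM ltnn (asboolF nAk) (asboolT Bk); lra.
  move: IH.
  case: asboolP => [/AB BM|_]; first by rewrite (asboolT BM); case: ifP => _; lra.
  by case: ifP => _; case: ifP => _; lra.
suff : binary_mass A <= binary_mass B - 2^-1 ^+ k.+1.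
  by have := weight_gt0 k; lra.
apply: ge_sup; first by exists (binary_sum A 0); exists 0%N.
move=> _ [N _ <-]; have := step (maxn N k.+1); rewrite leq_maxr.
have := binary_sum_mono A (leq_maxl N k.+1).
by have := binary_sum_le_mass B (maxn N k.+1); lra.
Qed.

End BinaryMass.

(** The rank of [x] is governed by the mass of the codes strictly below [x]. If [le x y] fails, the
    code of [y] lies below [x] but not below [y], which makes the rank strict. *)
Lemma strict_rank (R : realType) (T : Type) (code : T -> nat)
    (le : T -> T -> Prop) :
    injective code ->
    (forall x y z, le x y -> le y z -> le x z) ->
    (forall x y, le x y \/ le y x) ->
  exists s : T -> R, (forall x, 0 < s x < 1) /\
    (forall x y, s x <= s y <-> le x y).
Proof.
move=> codeI tr tot; have refl x : le x x by have [] := tot x x.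
pose below x : set nat := [set i | exists2 y, code y = i & ~ le x y].
have belowS x y : le x y -> below x `<=` below y.
  by move=> xy _ [z <- nxz]; exists z => //= /(tr _ _ _ xy).
(* The affine map sends [0, 1] to [1/4, 1/2], away from both endpoints. *)
exists (fun x => (1 + binary_mass R (below x)) / 4); split.
  by move=> x; have := binary_mass_itv R (below x); lra.
move=> x y; split=> [|/belowS/(binary_mass_le R)]; last lra.
apply: contraPP => nxy; have yx : le y x by have [] := tot x y.
suff : binary_mass R (below y) < binary_mass R (below x) by lra.
apply: (@binary_mass_lt _ _ _ (code y)); [exact: belowS|by exists y|].
by move=> [z /codeI -> ]; exact.
Qed.

(** * Propositional completeness with control over the values *)

(** Generic trees over a countable type are countable, so this encoding numbers the formulas. *)
Fixpoint fml_tree (V : Type) m (p : fml V m) : GenTree.tree V :=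
  match p with
  | Atom v => GenTree.Leaf v
  | Bot => GenTree.Node 0 [::]
  | And p q => GenTree.Node 1 [:: fml_tree p; fml_tree q]
  | Imp p q => GenTree.Node 2 [:: fml_tree p; fml_tree q]
  | Modal p => GenTree.Node 3 [:: fml_tree p]
  end.

Lemma fml_tree_inj V m : injective (@fml_tree V m).
Proof.
elim=> [v||p IHp q IHq|p IHp q IHq|p IHp] [w||r s|r s|r] //=.
- by case=> ->.
- by case=> /IHp -> /IHq ->.
- by case=> /IHp -> /IHq ->.
- by case=> /IHp ->.
Qed.

(** Provable implication in a linear extension [X] is a total preorder on countably many formulas.
    Its order embedding respects the connectives because they are determined by the order together
    with 0 and 1, so the intermediate values can be rescaled into any interval. *)
Lemma hom_extension (R : realType) (V : countType) m (L : logic V m)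
    (S D : set (fml V m)) (a b : R) :
    @godel_axiom V m `<=` logic_axiom L ->
    (forall d e, D d -> D e -> exists f, [/\ D f,
       derives L set0 (d ==> f)%fml & derives L set0 (e ==> f)%fml]) ->
    D !=set0 ->
    (forall d, D d -> ~ derives L S d) ->
    0 <= a -> a < b -> b <= 1 ->
  exists h : fml V m -> R, [/\ godel_hom h,
    (forall p, derives L S p -> h p = 1),
    (forall d, D d -> h d < 1) &
    (forall p, [\/ h p = 0, h p = 1 | a < h p < b])].
Proof.
move=> gL Ddir [d0 Dd0] SD a0 ab b1.
have [X [SX Xth Xlin XD]] := linear_extension gL Ddir SD.
have mp p q : X p -> X (p ==> q)%fml -> X q.
  by move=> Xp Xpq; apply: Xth; apply: (derives_mp (p := p)); exact: derives_hyp.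
have Xtr p q r : X (p ==> q)%fml -> X (q ==> r)%fml -> X (p ==> r)%fml.
  move=> pq qr; apply: Xth.
  by apply: (derives_trans gL (q := q)); exact: derives_hyp.
have XK p q : X q -> X (p ==> q)%fml.
  by move=> Xq; apply: Xth; apply: (derives_K gL); exact: derives_hyp.
have Xbot p : X (Bot ==> p)%fml by exact/Xth/(derives_godel gL)/godel_exfalso.
have Xcon : ~ X Bot by move=> /mp /(_ (Xbot d0)); exact: XD.
have Xid p : X (p ==> p)%fml by exact/Xth/(derives_id gL).
have Xandl p q : X (p && q ==> p)%fml by exact/Xth/(derives_andl gL).
have Xandr p q : X (p && q ==> q)%fml by exact/Xth/(derives_andr gL).
have Xand r p q : X (r ==> p)%fml -> X (r ==> q)%fml -> X (r ==> p && q)%fml.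
  move=> rp rq; apply: Xth; have hyp := @derives_hyp _ _ L X.
  apply: (derives_S gL (hyp _ rq)); apply: (derives_trans gL (hyp _ rp)).
  exact: (derives_curry gL (derives_id gL _ _)).
have Xmp p q : X ((p ==> q) && p ==> q)%fml.
  exact/Xth/(derives_uncurry gL)/(derives_id gL).
have [s [s01 sle]] := @strict_rank R _ (pickle \o @fml_tree V m)
  (fun p q => X (p ==> q)%fml) (inj_comp (pcan_inj pickleK) (@fml_tree_inj V m))
  Xtr (fun p q => Xlin p q).
(* The classes of [X] and of the formulas refuted by [X] are the top and bottom of the chain; they
   are pinned to 1 and 0, and everything else is squeezed between [a] and [b]. *)
pose h p := if `[< X p >] then 1 else if `[< X (~~ p)%fml >] then 0
  else a + (b - a) * s p.
have hmid p : a < a + (b - a) * s p < b.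
  by have /andP[? ?] := s01 p; apply/andP; split; nra.
have h01 p : 0 <= h p <= 1.
  rewrite /h; have /andP[? ?] := hmid p.
  by case: ifP => _; last case: ifP => _; lra.
have h1 p : X p <-> h p = 1.
  rewrite /h; case: asboolP => // nXp; split=> //.
  have /andP[? ?] := hmid p.
  by case: ifP => _ => [/eqP|]; [rewrite eq_sym oner_eq0|lra].
have h0 p : X (~~ p)%fml <-> h p = 0.
  rewrite /h; case: asboolP => [Xp|_].
    split=> [/(mp _ _ Xp)//|/eqP]; by rewrite oner_eq0.
  case: asboolP => // nXp; split=> // h0; have /andP[? ?] := hmid p; lra.
have hle p q : h p <= h q <-> X (p ==> q)%fml.
  split=> [pq|pq].
    have [//|qp] := Xlin p q.
    have [Xq|nXq] := pselect (X q); first exact: XK.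
    have [Xnp|nXnp] := pselect (X (~~ p)%fml); first exact: Xtr Xnp (Xbot q).
    have nXp : ~ X p.
      by move=> /h1 hp; apply: nXq; apply/h1; have := h01 q; lra.
    have nXnq : ~ X (~~ q)%fml.
      move=> /h0 hq; apply: nXnp; apply/h0; have := h01 p; lra.
    apply/sle; move: pq; rewrite /h !asboolF // lerD2l ler_pM2l //; lra.
  have [Xq|nXq] := pselect (X q).
    by move/h1: Xq => ->; case/andP: (h01 p).
  have [Xnp|nXnp] := pselect (X (~~ p)%fml).
    by move/h0: Xnp => ->; case/andP: (h01 q).
  have nXp : ~ X p by move=> /mp /(_ pq).
  have nXnq : ~ X (~~ q)%fml by move=> /(Xtr _ _ _ pq).
  rewrite /h !asboolF // lerD2l ler_pM2l; first exact/sle.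
  lra.
exists h; split.
- split=> //.
  + exact/h0/Xid.
  + move=> p q; have [/hle pq|/ltW/hle qp] := leP (h p) (h q).
      apply/le_anti/andP; split; apply/hle; first exact: Xandl.
      exact: Xand (Xid p) pq.
    apply/le_anti/andP; split; apply/hle; first exact: Xandr.
    exact: Xand qp (Xid q).
  + move=> p q; case: gimpP => [/hle/h1//|qp].
    apply/le_anti/andP; split; apply/hle; last first.
      exact/Xth/(derives_curry gL)/(derives_andl gL).
    have nXpq : ~ X (p ==> q)%fml by move=> /hle; rewrite leNgt qp.
    (* If [p] were below [p ==> q], modus ponens would put [p] below [q]; so [p ==> q] is below [p],
       and modus ponens puts it below [q]. *)
    have [ppq|pqp] := Xlin p (p ==> q)%fml.
      by case: nXpq; apply: Xtr (Xmp p q); exact: Xand.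
    by apply: Xtr (Xmp p q); exact: Xand.
- by move=> p /(derives_cut (fun q Sq => derives_hyp L (SX q Sq)))/Xth/h1.
- by move=> d /XD nXd; rewrite lt_neqAle; case/andP: (h01 d) => _ ->;
    rewrite andbT; apply/eqP => /h1.
- move=> p; have [/h1|nXp] := pselect (X p); first by constructor 2.
  have [/h0|nXnp] := pselect (X (~~ p)%fml); first by constructor 1.
  by constructor 3; rewrite /h !asboolF.
Qed.

(** * Validity of the axioms and rules in GK-models *)

Lemma gimp_mp (R : realType) (a b t : R) : t <= gimp a b -> t <= a -> t <= b.
Proof. by case: gimpP => // ab _ ta; exact: le_trans ab. Qed.

(** Residuation in forcing style: quantifying over thresholds [t] lets many-valued arguments be run
    as Kripke arguments at level [t]. *)
Lemma gimp_intro (R : realType) (a b c : R) : c <= 1 ->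
  (forall t, t <= c -> t <= a -> t <= b) -> c <= gimp a b.
Proof.
by move=> c1 H; rewrite le_gimp //; apply: H; rewrite ge_min lexx ?orbT.
Qed.

Section Semantics.
Context {R : realType} {V : Type} {M : gk_model R V}.
Implicit Types (x y : world M) (c t : R).

Lemma eval_box_le x y (p : fml V Box) :
  (forall z : world M, 0 <= eval z p <= 1) ->
  eval x (□ p)%fml <= gimp (acc x y) (eval y p).
Proof.
move=> p01 /=; apply: ge_inf; last by exists y.
by exists 0 => _ [z _ <-]; case/andP: (gimp_itv (acc x z) (p01 z)).
Qed.

Lemma le_eval_box c x (p : fml V Box) :
  (forall y, c <= gimp (acc x y) (eval y p)) -> c <= eval x (□ p)%fml.
Proof.
move=> H /=; apply: lb_le_inf => [|_ [y _ <-]]; last exact: H.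
by exists (gimp (acc x x) (eval x p)); exists x.
Qed.

Lemma le_eval_diamond x y (p : fml V Diamond) :
  Num.min (acc x y) (eval y p) <= eval x (◇ p)%fml.
Proof.
apply: ub_le_sup; last by exists y.
by exists 1 => _ [z _ <-]; rewrite ge_min; case/andP: (acc_itv x z) => _ ->.
Qed.

Lemma eval_diamond_le c x (p : fml V Diamond) :
  (forall y, Num.min (acc x y) (eval y p) <= c) -> eval x (◇ p)%fml <= c.
Proof.
move=> H /=; apply: ge_sup => [|_ [y _ <-]]; last exact: H.
by exists (Num.min (acc x x) (eval x p)); exists x.
Qed.

Lemma eval_itv m x (p : fml V m) : 0 <= eval x p <= 1.
Proof.
elim: p x => [v||p IHp q IHq|p IHp q IHq|p IHp] x.
- exact: valuation_itv.
- by rewrite /= lexx ler01.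
- by rewrite /= minElt; case: ifP.
- by rewrite /= gimp_itv.
- case: m p IHp => p IHp; apply/andP; split.
  + by apply: le_eval_box => y; case/andP: (gimp_itv (acc x y) (IHp y)).
  + apply: le_trans (eval_box_le x x IHp) _.
    by case/andP: (gimp_itv (acc x x) (IHp x)).
  + apply: le_trans (le_eval_diamond x x p).
    by rewrite le_min; case/andP: (acc_itv x x) => ->; case/andP: (IHp x) => ->.
  + apply: eval_diamond_le => y; rewrite ge_min.
    by case/andP: (acc_itv x y) => _ ->.
Qed.

Lemma eval_hom m x : godel_hom (eval (m := m) x).
Proof. by split=> // p; exact: eval_itv. Qed.

Lemma eval_imp1 m x (p q : fml V m) :
  eval x (p ==> q)%fml = 1 <-> eval x p <= eval x q.
Proof. exact: (hom_imp1 _ _ (eval_hom m x)). Qed.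

Lemma eval_box_mp t x y (p : fml V Box) :
  t <= eval x (□ p)%fml -> t <= acc x y -> t <= eval y p.
Proof.
move=> tp; apply: gimp_mp; apply: le_trans tp _.
by apply: eval_box_le => z; exact: eval_itv.
Qed.

Lemma le_eval_boxP c x (p : fml V Box) : c <= 1 ->
  (forall t y, t <= c -> t <= acc x y -> t <= eval y p) ->
  c <= eval x (□ p)%fml.
Proof.
move=> c1 H; apply: le_eval_box => y; apply: gimp_intro => // t tc.
exact: H.
Qed.

Lemma box_axiom_valid x (p : fml V Box) : box_axiom p -> eval x p = 1.
Proof.
have le1 (z : world M) (q : fml V Box) : eval z q <= 1.
  by case/andP: (eval_itv z q).
case=> [q r|q]; apply/eval_imp1.
  rewrite (hom_imp (eval_hom _ x)).
  apply: gimp_intro => [|s sqr sq]; first exact: le1.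
  apply: le_eval_boxP => [|t y ts txy].
    exact: le_trans sq (le1 _ _).
  apply: gimp_mp (eval_box_mp (le_trans ts sqr) txy) _.
  exact: eval_box_mp (le_trans ts sq) txy.
rewrite (hom_negneg _ (eval_hom _ x)).
have /andP[b0 b1] := eval_itv x (□ q)%fml.
case: ifP => [_|nz]; first by case/andP: (eval_itv x (□ ~~ ~~ q)%fml).
apply: le_eval_boxP => // t y _ txy; rewrite (hom_negneg _ (eval_hom _ y)).
case: ifP => [/eqP qy|_]; last first.
  by apply: le_trans txy _; case/andP: (acc_itv x y).
have bpos : 0 < eval x (□ q)%fml by rewrite lt_neqAle eq_sym nz.
case: (leP t 0) => // t0.
(* This threshold is positive, yet it would be at most the value 0 of [q] at [y]. *)
have := @eval_box_mp (Num.min t (eval x (□ q)%fml)) x y q.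
by rewrite !ge_min lexx txy orbT qy => /(_ isT isT); rewrite !leNgt t0 bpos.
Qed.

Lemma box_nec_valid (p : fml V Box) x :
  (forall y, eval y p = 1) -> eval x (□ p)%fml = 1.
Proof.
move=> H; apply/le_anti/andP; split; first by case/andP: (eval_itv x (□ p)%fml).
apply: le_eval_boxP => // t y t1 _; by rewrite H.
Qed.

Lemma T_box_valid x (p : fml V Box) :
  gk_reflexive M -> T_box p -> eval x p = 1.
Proof.
move=> refl [q]; apply/eval_imp1; apply: (@eval_box_mp _ x x) => //.
by rewrite refl; case/andP: (eval_itv x (□ q)%fml).
Qed.

Lemma Four_box_valid x (p : fml V Box) :
  gk_transitive M -> Four_box p -> eval x p = 1.
Proof.
move=> tr [q]; apply/eval_imp1.
have /andP[_ b1] := eval_itv x (□ q)%fml.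
apply: le_eval_boxP => // s y sb sxy; apply: le_eval_boxP => [|t z ts tyz].
  exact: le_trans sb b1.
apply: (eval_box_mp (le_trans ts sb)); apply: le_trans (tr x y z).
by rewrite le_min tyz andbT; exact: le_trans sxy.
Qed.

Lemma diamond_axiom_valid x (p : fml V Diamond) :
  diamond_axiom p -> eval x p = 1.
Proof.
case=> [q r|q|]; apply/eval_imp1; last first.
- by apply: eval_diamond_le => y; rewrite ge_min lexx orbT.
- rewrite (hom_negneg _ (eval_hom _ x)).
  case: ifP => [/eqP qx|_]; last by case/andP: (eval_itv x (◇ ~~ ~~ q)%fml).
  apply: eval_diamond_le => y; rewrite (hom_negneg _ (eval_hom _ y)).
  case: ifP => [_|nz]; first by rewrite ge_min lexx orbT.
  have /andP[q0 _] := eval_itv y q.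
  have qpos : 0 < eval y q by rewrite lt_neqAle eq_sym nz.
  have := le_eval_diamond x y q; rewrite qx !ge_min.
  by case/orP=> [-> //|]; rewrite leNgt qpos.
- rewrite (hom_or _ _ (eval_hom _ x)); apply: eval_diamond_le => y.
  rewrite (hom_or _ _ (eval_hom _ y)) le_max maxEle.
  by case: ifP => _; rewrite le_eval_diamond ?orbT.
Qed.

Lemma diamond_mono_valid x (p q : fml V Diamond) :
  (forall y, eval y (p ==> q)%fml = 1) -> eval x (◇ p ==> ◇ q)%fml = 1.
Proof.
move=> pq; apply/eval_imp1; apply: eval_diamond_le => y.
apply: le_trans (le_eval_diamond x y q); rewrite le_min ge_min lexx /= ge_min.
by have /eval_imp1 -> := pq y; rewrite orbT.
Qed.

Lemma T_diamond_valid x (p : fml V Diamond) :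
  gk_reflexive M -> T_diamond p -> eval x p = 1.
Proof.
move=> refl [q]; apply/eval_imp1; apply: le_trans (le_eval_diamond x x q).
by rewrite refl le_min lexx; case/andP: (eval_itv x q) => _ ->.
Qed.

Lemma Four_diamond_valid x (p : fml V Diamond) :
  gk_transitive M -> Four_diamond p -> eval x p = 1.
Proof.
move=> tr [q]; apply/eval_imp1; apply: eval_diamond_le => y.
(* Moving [acc x y] to the right by residuation leaves the inner supremum alone on the left, where
   it can be bounded world by world. *)
suff H : eval y (◇ q)%fml <= gimp (acc x y) (eval x (◇ q)%fml).
  by apply: (gimp_mp (le_trans _ H)); rewrite ge_min lexx ?orbT.
apply: eval_diamond_le => z; apply: gimp_intro => [|t].
  by rewrite ge_min; case/andP: (acc_itv y z) => _ ->.
rewrite le_min => /andP[tyz tz] txy; apply: le_trans (le_eval_diamond x z q).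
by rewrite le_min tz andbT; apply: le_trans (tr x y z); rewrite le_min txy.
Qed.

End Semantics.

(** * Canonical worlds and their existence *)

Section CanonicalWorlds.
Context (R : realType) (V : countType) (m : modality) (L : logic V m).
Hypothesis godelL : @godel_axiom V m `<=` logic_axiom L.
Implicit Types (S D : set (fml V m)) (p q : fml V m).

(** Propositional completeness, which replaces formal derivations of facts about the defined
    disjunction by computations in [0, 1]. *)
Lemma hom_complete p :
  (forall h : fml V m -> R, godel_hom h -> h p = 1) -> derives L set0 p.
Proof.
move=> H; apply: contrapT => np.
have [||d -> //|h [hh _ /(_ p erefl)]] :=
    @hom_extension R V m L set0 [set p] 0 1 godelL _ _ _ (lexx _) ltr01 (lexx _).
- move=> _ _ -> ->; exists p.
  by split=> //; exact: derives_id.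
- by exists p.
- by rewrite (H h hh) ltxx.
Qed.

Lemma derives_orl p q : derives L set0 (p ==> p || q)%fml.
Proof.
apply: hom_complete => h hh; apply/hom_imp1 => //.
by rewrite hom_or // le_max lexx.
Qed.

Lemma derives_orr p q : derives L set0 (q ==> p || q)%fml.
Proof.
apply: hom_complete => h hh; apply/hom_imp1 => //.
by rewrite hom_or // le_max lexx orbT.
Qed.

(* The values of a world accumulate nowhere near 0: this is what lets, in the  *)
(* diamond case, all intermediate values of a successor lie below every       *)
(* nonzero value of the given world.                                          *)
Definition canonical_world := {h : fml V m -> R | [/\ godel_hom h,
  (forall p, derives L set0 p -> h p = 1) &
  exists2 d, 0 < d <= 1 & forall p, h p = 0 \/ d <= h p]}.

Lemma canonical_world_hom (w : canonical_world) : godel_hom (sval w).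
Proof. by case: w => h []. Qed.

Lemma canonical_world_theorem (w : canonical_world) p :
  derives L set0 p -> sval w p = 1.
Proof. by case: w p => h [_ th _] /=. Qed.

Lemma canonical_world_imp (w : canonical_world) p q :
  derives L set0 (p ==> q)%fml -> sval w p <= sval w q.
Proof.
by move=> /(canonical_world_theorem w)/(hom_imp1 _ _ (canonical_world_hom w)).
Qed.

(** The positive left end [a] itself serves as the gap between 0 and the other values. *)
Lemma canonical_world_exists S D (a b : R) :
    (forall d e, D d -> D e -> exists f, [/\ D f,
       derives L set0 (d ==> f)%fml & derives L set0 (e ==> f)%fml]) ->
    D !=set0 ->
    (forall d, D d -> ~ derives L S d) ->
    0 < a -> a < b -> b <= 1 ->
  exists w : canonical_world, [/\
    (forall p, S p -> sval w p = 1),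
    (forall d, D d -> sval w d < 1) &
    (forall p, [\/ sval w p = 0, sval w p = 1 | a < sval w p < b])].
Proof.
move=> Ddir D0 SD a0 ab b1.
have [h [hh hS hD hab]] := @hom_extension R V m L S D a b godelL Ddir D0 SD
  (ltW a0) ab b1.
have hw : [/\ godel_hom h, (forall p, derives L set0 p -> h p = 1) &
    exists2 d, 0 < d <= 1 & forall p, h p = 0 \/ d <= h p].
  split=> //; first by move=> p /(derives_theorem S)/hS.
  exists a => [|p]; first by rewrite a0; lra.
  by have [|->|/andP[/ltW]] := hab p; [left|right; lra|right].
by exists (exist _ h hw); split=> //= p Sp; apply: hS; exact: derives_hyp.
Qed.

Lemma canonical_world_separates S p : ~ derives L S p ->
  exists w : canonical_world, (forall q, S q -> sval w q = 1) /\ sval w p < 1.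
Proof.
move=> Sp.
have [||_ -> //||||w [wS wp _]] := @canonical_world_exists S [set p] 2^-1 1.
- move=> _ _ -> ->; exists p.
  by split=> //; exact: derives_id.
- by exists p.
- by lra.
- by lra.
- by [].
- by exists w; split=> //; exact: wp.
Qed.

End CanonicalWorlds.

(** * The canonical model for the box *)

Section CanonicalBox.
Context {R : realType} {V : countType} {L : logic V Box}.
Hypothesis godelL : @godel_axiom V Box `<=` logic_axiom L.
Hypothesis boxL : @box_axiom V `<=` logic_axiom L.
Hypothesis necL : forall p q, box_rule p q -> logic_rule L p q.
Implicit Types v w : canonical_world R L.

Definition box_acc v w : R :=
  if `[< forall p, sval v (□ p)%fml <= sval w p >] then 1 else 0.

Lemma box_acc_itv v w : 0 <= box_acc v w <= 1.
Proof. by rewrite /box_acc; case: ifP => _; rewrite ?lexx ?ler01. Qed.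

Definition canonical_box w0 : gk_model R V := @GKModel R V
  (canonical_world R L) box_acc (fun w x => sval w (Atom x)) (inhabits w0)
  box_acc_itv (fun w x => hom_itv (canonical_world_hom w) (Atom x)).

Lemma canonical_box_reflexive w0 :
  @T_box V `<=` logic_axiom L -> gk_reflexive (canonical_box w0).
Proof.
move=> TL w; rewrite /= /box_acc asboolT // => p.
by apply: canonical_world_imp; apply/derives_axiom/TL.
Qed.

Lemma canonical_box_transitive w0 :
  @Four_box V `<=` logic_axiom L -> gk_transitive (canonical_box w0).
Proof.
move=> fourL u v w /=; have /andP[uw0 _] := box_acc_itv u w.
rewrite {1 2}/box_acc.
case: asboolP => [uv|_]; last by rewrite ge_min uw0.
case: asboolP => [vw|_]; last by rewrite ge_min uw0 orbT.
rewrite minxx /box_acc asboolT ?lexx // => p; apply: le_trans (vw p).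
apply: le_trans (uv (□ p)%fml).
by apply: canonical_world_imp; apply/derives_axiom/fourL.
Qed.

(** The formulas whose box exceeds [a] at [v] form a theory omitting [p]; a world satisfying it,
    refuting [p], with intermediate values just above [a], is a successor of [v]. The infimum is
    thus approached within every [e]. *)
Lemma canonical_box_witness v p : sval v (□ p)%fml < 1 ->
  forall e, 0 < e -> exists w, box_acc v w = 1 /\ sval w p < sval v (□ p)%fml + e.
Proof.
set a := sval v _ => a1 e e0; have hv := canonical_world_hom v.
have a0 : 0 <= a by exact: hom_ge0.
(* Necessitation handles axioms and rule conclusions, whose boxes have value 1 > [a]; axiom K
   handles modus ponens. *)
have closed q :
    derives L [set q | a < sval v (□ q)%fml] q -> a < sval v (□ q)%fml.
  move=> d; suff H S r : derives L S r ->
      S `<=` [set q | a < sval v (□ q)%fml] -> a < sval v (□ r)%fml.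
    exact: H d _.
  elim=> {S r} [S r Sr|S r ax|S r s _ IHr _ IHs|S r s dr _ ru] SS.
  - exact: SS.
  - rewrite (canonical_world_theorem v) //.
    apply: derives_modal (necL (box_nec r)); exact: derives_axiom.
  - have := canonical_world_imp v (derives_axiom set0 (boxL (box_K r s))).
    rewrite hom_imp //; have := IHs SS; have := IHr SS => ar ars le.
    have : a < Num.min (sval v (□ (r ==> s))%fml) (sval v (□ r)%fml).
      by rewrite lt_min ars.
    move/lt_le_trans; apply; apply: gimp_mp (le_trans _ le) _;
      by rewrite ge_min lexx ?orbT.
  - rewrite (canonical_world_theorem v) //.
    by apply: derives_modal (necL (box_nec s)); exact: derives_modal ru.
pose b := Num.min 1 (a + e).
have ab : a < b by rewrite lt_min a1 ltrDl.
have b1 : b <= 1 by rewrite ge_min lexx.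
have be : b <= a + e by rewrite ge_min lexx orbT.
(* Since [a] may be 0, the midpoint of [a] and [b] provides the positive left end. *)
have [||_ -> /closed||||w [wS wp wab]] := @canonical_world_exists R V Box L godelL
    [set q | a < sval v (□ q)%fml] [set p] ((a + b) / 2) b.
- move=> _ _ -> ->; exists p.
  by split=> //; exact: derives_id.
- by exists p.
- by rewrite ltxx.
- by lra.
- by lra.
- exact: b1.
- exists w; split; last first.
    have := wp p erefl; have [->|->|/andP[_]] := wab p; lra.
  rewrite /box_acc asboolT // => q.
  have [aq|qa] := ltP a (sval v (□ q)%fml).
    by rewrite wS //; exact: hom_le1.
  have [->|q0] := eqVneq (sval v (□ q)%fml) 0.
    exact/hom_ge0/canonical_world_hom.
  (* In the remaining case 0 < [sval v (□ q)] <= [a], axiom Z gives the box of [~~ ~~ q] value 1, so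
     [q] is nonzero at [w] and hence above [a]. *)
  have : sval w (~~ ~~ q)%fml = 1.
    apply: wS; apply: lt_le_trans a1 _.
    have := canonical_world_imp v (derives_axiom set0 (boxL (box_Z q))).
    by rewrite hom_negneg // (negbTE q0).
  rewrite hom_negneg; last exact: canonical_world_hom.
  case: eqVneq => [_ /eqP|wq _]; first by rewrite eq_sym oner_eq0.
  by have [/eqP|->|/andP[? _]] := wab q; [rewrite (negbTE wq)|lra|lra].
Qed.

Lemma canonical_box_eval w0 p (w : world (canonical_box w0)) :
  eval w p = sval w p.
Proof.
elim: p w => [x||p IHp q IHq|p IHp q IHq|p IHp] w /=.
- by [].
- by rewrite hom_bot //; exact: canonical_world_hom.
- by rewrite IHp IHq hom_and //; exact: canonical_world_hom.
- by rewrite IHp IHq hom_imp //; exact: canonical_world_hom.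
- apply/le_anti/andP; split; last first.
    apply: (@le_eval_box _ _ (canonical_box w0)) => u; rewrite IHp /= /box_acc.
    case: asboolP => [H|_].
      by rewrite gimp1l ?H //; exact/hom_le1/canonical_world_hom.
    rewrite /gimp hom_ge0; last exact: canonical_world_hom.
    exact/hom_le1/canonical_world_hom.
  have [a1|a1] := ltP (sval w (□ p)%fml) 1; last first.
    apply: le_trans a1.
    by case/andP: (@eval_itv _ _ (canonical_box w0) _ w (□ p)%fml).
  apply/ler_addgt0Pr => e /(canonical_box_witness a1)[u [wu up]].
  apply: le_trans (ltW up); rewrite -IHp.
  by apply: (@eval_box_mp _ _ (canonical_box w0) _ w) => //=; rewrite wu;
    case/andP: (@eval_itv _ _ (canonical_box w0) _ w (□ p)%fml).
Qed.

End CanonicalBox.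

(** * The canonical model for the diamond *)

Section CanonicalDiamond.
Context {R : realType} {V : countType} {L : logic V Diamond}.
Hypothesis godelL : @godel_axiom V Diamond `<=` logic_axiom L.
Hypothesis diamondL : @diamond_axiom V `<=` logic_axiom L.
Hypothesis monoL : forall p q, diamond_rule p q -> logic_rule L p q.
Implicit Types v w : canonical_world R L.

(** By residuation, the largest degree in [0, 1] whose minimum with [sval w p] is at most
    [sval v (◇ p)] for all [p]; one half of the truth lemma is thereby built in. *)
Definition diamond_acc v w : R :=
  inf (range (fun p => gimp (sval w p) (sval v (◇ p)%fml))).

Lemma diamond_acc_le v w p :
  diamond_acc v w <= gimp (sval w p) (sval v (◇ p)%fml).
Proof.
apply: ge_inf; last by exists p.
exists 0 => _ [q _ <-].
by have /andP[] := gimp_itv (sval w q)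
  (hom_itv (canonical_world_hom v) (◇ q)%fml).
Qed.

Lemma le_diamond_acc (c : R) v w :
  (forall p, c <= gimp (sval w p) (sval v (◇ p)%fml)) -> c <= diamond_acc v w.
Proof.
move=> H; apply: lb_le_inf => [|_ [p _ <-]]; last exact: H.
by exists (gimp (sval w Bot) (sval v (◇ Bot)%fml)); exists Bot.
Qed.

Lemma diamond_acc_itv v w : 0 <= diamond_acc v w <= 1.
Proof.
have g01 p := gimp_itv (sval w p) (hom_itv (canonical_world_hom v) (◇ p)%fml).
apply/andP; split; first by apply: le_diamond_acc => p; case/andP: (g01 p).
by apply: le_trans (diamond_acc_le v w Bot) _; case/andP: (g01 Bot).
Qed.

Definition canonical_diamond w0 : gk_model R V := @GKModel R V
  (canonical_world R L) diamond_acc (fun w x => sval w (Atom x)) (inhabits w0)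
  diamond_acc_itv (fun w x => hom_itv (canonical_world_hom w) (Atom x)).

Lemma canonical_diamond_reflexive w0 :
  @T_diamond V `<=` logic_axiom L -> gk_reflexive (canonical_diamond w0).
Proof.
move=> TL w; apply/le_anti/andP; split => /=.
  by case/andP: (diamond_acc_itv w w).
apply: le_diamond_acc => p; rewrite /gimp canonical_world_imp ?lexx //.
exact/derives_axiom/TL.
Qed.

Lemma canonical_diamond_transitive w0 :
  @Four_diamond V `<=` logic_axiom L -> gk_transitive (canonical_diamond w0).
Proof.
move=> fourL u v w /=; apply: le_diamond_acc => p.
apply: gimp_intro => [|t].
  by rewrite ge_min; case/andP: (diamond_acc_itv u v) => _ ->.
rewrite le_min => /andP[tuv tvw] tp.
have /le_trans : t <= sval v (◇ p)%fml.
  exact: gimp_mp (le_trans tvw (diamond_acc_le v w p)) tp.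
have := gimp_mp (le_trans tuv (diamond_acc_le u v (◇ p)%fml)).
move=> tup /(_ _ (lexx _)) /tup /le_trans; apply.
by apply: canonical_world_imp; exact/derives_axiom/fourL.
Qed.

(** The formulas whose diamond is below [a] are directed by axiom D, include [Bot] by axiom F, and
    are not derivable from [p] by monotonicity. A world satisfying [p] and refuting them attains the
    supremum. *)
Lemma canonical_diamond_witness v p : 0 < sval v (◇ p)%fml ->
  exists w, sval v (◇ p)%fml <= diamond_acc v w /\ sval w p = 1.
Proof.
set a := sval v _ => a0; have hv := canonical_world_hom v.
have [c /andP[c0 c1] vc] : exists2 d, 0 < d <= 1 &
    forall q, sval v q = 0 \/ d <= sval v q by case: (v) => h [].
have bot0 : sval v (◇ Bot)%fml = 0.
  have := canonical_world_theorem v (derives_axiom set0 (diamondL (diamond_F V))).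
  by rewrite hom_neg //; case: eqVneq => // _ /eqP; rewrite eq_sym oner_eq0.
(* Here [c] is the gap of [v] above 0: intermediate values of [w] stay below every nonzero value of
   [v]. *)
have [|||||| w [wp wD wab]] := @canonical_world_exists R V Diamond L godelL
    [set p] [set q | sval v (◇ q)%fml < a] (c / 2) c.
- move=> d e /= da ea; exists (d || e)%fml; split.
  + apply: le_lt_trans (canonical_world_imp v _) _.
      exact/derives_axiom/diamondL/diamond_D.
    by rewrite hom_or // gt_max da.
  + exact: derives_orl.
  + exact: derives_orr.
- by exists Bot; rewrite /= bot0.
- move=> d /= da pd; suff : a <= sval v (◇ d)%fml by rewrite leNgt da.
  apply: canonical_world_imp; apply: derives_modal (monoL (diamond_mono _ _)).
  by apply: deduction => //; rewrite set0U.
- by lra.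
- by lra.
- exact: c1.
- exists w; split; last exact: wp.
  apply: le_diamond_acc => q; have [aq|qa] := leP a (sval v (◇ q)%fml).
    by apply: le_trans aq (ge_gimp _ _); exact: hom_le1.
  suff wq : sval w q <= sval v (◇ q)%fml by rewrite /gimp wq; exact: hom_le1.
  have hw := canonical_world_hom w.
  have [q0|cq] := vc (◇ q)%fml; last first.
    have := wD q qa; have [->|->|/andP[_ wqc] _] := wab q.
    - by move=> _; exact: hom_ge0.
    - by rewrite ltxx.
    - exact: le_trans (ltW wqc) cq.
  (* When [sval v (◇ q)] is 0, axiom Z puts [~~ ~~ q] among the refuted formulas, which forces [q]
     to be 0 at [w]. *)
  have : sval w (~~ ~~ q)%fml < 1.
    apply: wD => /=; apply: le_lt_trans a0.
    have := canonical_world_imp v (derives_axiom set0 (diamondL (diamond_Z q))).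
    by rewrite hom_negneg // q0 eqxx.
  rewrite hom_negneg //; case: eqVneq => [-> _|_]; first exact: hom_ge0.
  by rewrite ltxx.
Qed.

Lemma canonical_diamond_eval w0 p (w : world (canonical_diamond w0)) :
  eval w p = sval w p.
Proof.
elim: p w => [x||p IHp q IHq|p IHp q IHq|p IHp] w /=.
- by [].
- by rewrite hom_bot //; exact: canonical_world_hom.
- by rewrite IHp IHq hom_and //; exact: canonical_world_hom.
- by rewrite IHp IHq hom_imp //; exact: canonical_world_hom.
- apply/le_anti/andP; split.
    apply: (@eval_diamond_le _ _ (canonical_diamond w0)) => u; rewrite IHp /=.
    apply: gimp_mp (le_trans _ (diamond_acc_le w u p)) _;
      by rewrite ge_min lexx ?orbT.
  have [a0|a0] := leP (sval w (◇ p)%fml) 0.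
    by apply: le_trans a0 _;
      case/andP: (@eval_itv _ _ (canonical_diamond w0) _ w (◇ p)%fml).
  have [u [wu up]] := canonical_diamond_witness a0.
  apply: le_trans (@le_eval_diamond _ _ (canonical_diamond w0) w u p).
  by rewrite IHp up le_min wu; exact/hom_le1/canonical_world_hom.
Qed.

End CanonicalDiamond.

(** * Soundness, and reduction to countably many variables *)

Lemma soundness (R : realType) V m (L : logic V m) (C : gk_model R V -> Prop) :
    (forall p, logic_axiom L p -> entails C set0 p) ->
    (forall p q, logic_rule L p q -> entails C set0 p -> entails C set0 q) ->
  forall T p, derives L T p -> entails C T p.
Proof.
move=> axC ruC T p; elim=> {T p}.
- by move=> T p Tp M _ x; exact.
- by move=> T p /axC valid M CM x _; exact: valid.
- move=> T p q _ IHp _ IHpq M CM x Tx.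
  have := IHpq M CM x Tx; rewrite /= IHp //.
  by rewrite gimp1l //; case/andP: (eval_itv x q).
- by move=> T p q _ IHp ru M CM x _; exact: (ruC _ _ ru IHp).
Qed.

Fixpoint fsubst V W m (s : V -> fml W m) (p : fml V m) : fml W m :=
  match p with
  | Atom v => s v
  | Bot => Bot
  | And p q => And (fsubst s p) (fsubst s q)
  | Imp p q => Imp (fsubst s p) (fsubst s q)
  | Modal p => Modal (fsubst s p)
  end.

Fixpoint fml_vars V m (p : fml V m) : set V :=
  match p with
  | Atom v => [set v]
  | Bot => set0
  | And p q | Imp p q => fml_vars p `|` fml_vars q
  | Modal p => fml_vars p
  end.

Lemma finite_fml_vars V m (p : fml V m) : finite_set (fml_vars p).
Proof. by elim: p => //= *; rewrite finite_setU. Qed.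

Lemma fsubst_rename V W m (A : set V) (s : V -> W) (t : W -> fml V m) :
  (forall v, A v -> t (s v) = Atom v) ->
  forall p : fml V m, fml_vars p `<=` A -> fsubst t (fsubst (Atom \o s) p) = p.
Proof.
move=> ts; elim=> [v||p IHp q IHq|p IHp q IHq|p IHp] //= pA.
- exact/ts/pA.
- by rewrite IHp ?IHq // => v vA; apply: pA; [right|left].
- by rewrite IHp ?IHq // => v vA; apply: pA; [right|left].
- by rewrite IHp.
Qed.

Lemma derives_fsubst V W m (L : logic V m) (L' : logic W m) (s : V -> fml W m) :
    (forall p, logic_axiom L p -> logic_axiom L' (fsubst s p)) ->
    (forall p q, logic_rule L p q -> logic_rule L' (fsubst s p) (fsubst s q)) ->
  forall T p, derives L T p -> derives L' (fsubst s @` T) (fsubst s p).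
Proof.
move=> axs rus T p; elim=> {T p}.
- by move=> T p Tp; apply: derives_hyp; exists p.
- by move=> T p /axs; exact: derives_axiom.
- by move=> T p q _ IHp _ IHpq; exact: derives_mp IHp IHpq.
- move=> T p q _ IHp /rus ru; apply: derives_modal ru.
  by rewrite image_set0 in IHp.
Qed.

Definition rename_model (R : realType) V W (s : V -> W) (M : gk_model R W) :=
  @GKModel R V (world M) (@acc _ _ M) (fun x v => valuation x (s v))
    (world_inhabited M) (@acc_itv _ _ M)
    (fun x v => valuation_itv x (s v)).

Lemma eval_rename (R : realType) V W m (s : V -> W) (M : gk_model R W)
    (x : world M) (p : fml V m) :
  @eval R V m (rename_model s M) x p = eval x (fsubst (Atom \o s) p).
Proof.
elim: p x => [v||p IHp q IHq|p IHp q IHq|p IHp] x //=; rewrite ?IHp ?IHq //.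
case: m p IHp => p IHp; [congr inf|congr sup];
  by apply: eq_imagel => y _; rewrite IHp.
Qed.

(** Only countably many variables occur in [T] and [p], so they can be renamed injectively into
    [nat]. Derivations come back by the inverse substitution, countermodels by [rename_model], which
    keeps the accessibility relation; hence [Frame] speaks of that relation only. *)
Lemma strongly_complete_of_nat (R : realType) m
    (Frame : forall W : Type, (W -> W -> R) -> Prop)
    (L : forall V, logic V m) (V : Type) :
    (forall p, logic_axiom (L V) p ->
       entails (fun M : gk_model R V => Frame _ (@acc _ _ M)) set0 p) ->
    (forall p q, logic_rule (L V) p q ->
       entails (fun M : gk_model R V => Frame _ (@acc _ _ M)) set0 p ->
       entails (fun M : gk_model R V => Frame _ (@acc _ _ M)) set0 q) ->
    (forall (s : nat -> fml V m) p,
       logic_axiom (L nat) p -> logic_axiom (L V) (fsubst s p)) ->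
    (forall (s : nat -> fml V m) p q, logic_rule (L nat) p q ->
       logic_rule (L V) (fsubst s p) (fsubst s q)) ->
    (forall T p, ~ derives (L nat) T p ->
       exists (M : gk_model R nat) (x : world M), [/\ Frame _ (@acc _ _ M),
         (forall q, T q -> eval x q = 1) & eval x p < 1]) ->
  strongly_complete (L V) (fun M : gk_model R V => Frame _ (@acc _ _ M)).
Proof.
move=> axC ruC axs rus counter T p Tcount; split; first exact: soundness.
apply: contraPP => Tp TCp.
pose A := fml_vars p `|` \bigcup_(q in T) fml_vars q.
have : countable A.
  rewrite /A -bigcup2E; apply: bigcup_countable => // -[|[|i]] _ /=.
  - exact/finite_set_countable/finite_fml_vars.
  - apply: bigcup_countable => // q _.
    exact/finite_set_countable/finite_fml_vars.
  - exact: countable0.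
move=> /countable_injP[s sI].
(* A left inverse of [s] on [A]; the value [Bot] off the image is arbitrary. *)
pose t n : fml V m :=
  if pselect (exists v, A v /\ s v = n) is left e then Atom (projT1 (cid e))
  else Bot.
have ts v : A v -> t (s v) = Atom v.
  move=> Av; rewrite /t; case: pselect => [e|[]]; last by exists v.
  by case: cid => w [Aw /= sw]; congr Atom; apply: sI; rewrite ?inE.
pose r := fsubst (m := m) (Atom \o s).
have rK q : fml_vars q `<=` A -> fsubst t (r q) = q by exact: fsubst_rename.
have rT : fsubst t @` (r @` T) = T.
  have rKT q : T q -> fsubst t (r q) = q.
    by move=> Tq; apply: rK => v qv; right; exists q.
  apply/seteqP; split => [_ [_ [q Tq <-] <-]|q Tq]; first by rewrite rKT.
  by exists (r q); [exists q|exact: rKT].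
have nrT : ~ derives (L nat) (r @` T) (r p).
  move=> /(derives_fsubst (axs t) (rus t)); rewrite rT rK //.
  by move=> v pv; left.
have [M [x [FM MT Mp]]] := counter _ _ nrT.
have := TCp (rename_model s M) FM x; rewrite eval_rename => Mp1.
move: Mp; rewrite Mp1 ?ltxx // => q Tq.
by rewrite eval_rename; apply: MT; exists q.
Qed.

Lemma fsubst_godel_axiom V W m (s : V -> fml W m) p :
  godel_axiom p -> godel_axiom (fsubst s p).
Proof. by case=> *; constructor. Qed.

(** * Completeness of extensions by canonical schemes *)

(** A scheme only has to be valid on the frames, closed under substitution and canonical, that is,
    to force the frame condition on [box_acc]. *)
Lemma box_strongly_complete (R : realType)
    (Frame : forall W : Type, (W -> W -> R) -> Prop)
    (A : forall V, set (fml V Box)) (V : Type) :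
    (forall p, A V p ->
       entails (fun M : gk_model R V => Frame _ (@acc _ _ M)) set0 p) ->
    (forall (s : nat -> fml V Box) p, A nat p -> A V (fsubst s p)) ->
    Frame _ (@box_acc R nat (add_scheme (G_box nat) (A nat))) ->
  strongly_complete (add_scheme (G_box V) (A V))
    (fun M : gk_model R V => Frame _ (@acc _ _ M)).
Proof.
move=> validA substA FA.
apply: (strongly_complete_of_nat (L := fun V => add_scheme (G_box V) (A V))).
- move=> p [[ax|ax]|/validA//] M _ x _.
    exact: hom_godel_axiom (eval_hom _ x) ax.
  exact: box_axiom_valid.
- move=> p _ [{}p] valid M FM x _; apply: box_nec_valid => y; exact: valid.
- move=> s p [[/fsubst_godel_axiom ax|[q r|q]]|/substA ax].
  + by left; left.
  + by left; right; constructor.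
  + by left; right; constructor.
  + by right.
- by move=> s p q []; constructor.
- move=> T p Tp.
  have godelL : @godel_axiom nat Box `<=`
    logic_axiom (add_scheme (G_box nat) (A nat)) by move=> q; left; left.
  have boxL : @box_axiom nat `<=`
    logic_axiom (add_scheme (G_box nat) (A nat)) by move=> q; left; right.
  (* Besides refuting [p], this world shows that the canonical model is inhabited. *)
  have [w [wT wp]] := canonical_world_separates R godelL Tp.
  exists (canonical_box w), w; split; first exact: FA.
    by move=> q Tq; rewrite canonical_box_eval //; exact: wT.
  by rewrite canonical_box_eval.
Qed.

Lemma diamond_strongly_complete (R : realType)
    (Frame : forall W : Type, (W -> W -> R) -> Prop)
    (A : forall V, set (fml V Diamond)) (V : Type) :
    (forall p, A V p ->
       entails (fun M : gk_model R V => Frame _ (@acc _ _ M)) set0 p) ->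
    (forall (s : nat -> fml V Diamond) p, A nat p -> A V (fsubst s p)) ->
    Frame _ (@diamond_acc R nat (add_scheme (G_diamond nat) (A nat))) ->
  strongly_complete (add_scheme (G_diamond V) (A V))
    (fun M : gk_model R V => Frame _ (@acc _ _ M)).
Proof.
move=> validA substA FA.
apply: (strongly_complete_of_nat (L := fun V => add_scheme (G_diamond V) (A V))).
- move=> p [[ax|ax]|/validA//] M _ x _.
    exact: hom_godel_axiom (eval_hom _ x) ax.
  exact: diamond_axiom_valid.
- move=> _ _ [p q] valid M FM x _; apply: diamond_mono_valid => y; exact: valid.
- move=> s p [[/fsubst_godel_axiom ax|[q r|q|]]|/substA ax].
  + by left; left.
  + by left; right; constructor.
  + by left; right; constructor.
  + by left; right; constructor.
  + by right.
- by move=> s p q []; constructor.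
- move=> T p Tp.
  have godelL : @godel_axiom nat Diamond `<=`
    logic_axiom (add_scheme (G_diamond nat) (A nat)) by move=> q; left; left.
  have diamondL : @diamond_axiom nat `<=`
    logic_axiom (add_scheme (G_diamond nat) (A nat)) by move=> q; left; right.
  have [w [wT wp]] := canonical_world_separates R godelL Tp.
  exists (canonical_diamond w), w; split; first exact: FA.
    by move=> q Tq; rewrite canonical_diamond_eval //; exact: wT.
  by rewrite canonical_diamond_eval.
Qed.

Lemma add_schemeA V m (L : logic V m) (A B : set (fml V m)) :
  add_scheme (add_scheme L A) B = add_scheme L (A `|` B).
Proof. by rewrite /add_scheme /= setUA. Qed.

Theorem theorem20 (R : realType) (Var : Type) :
  (strongly_complete (add_scheme (G_box Var) (@T_box Var))
     (fun M : gk_model R Var => gk_reflexive M) /\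
   strongly_complete (add_scheme (G_diamond Var) (@T_diamond Var))
     (fun M : gk_model R Var => gk_reflexive M)) /\
  (strongly_complete (add_scheme (G_box Var) (@Four_box Var))
     (fun M : gk_model R Var => gk_transitive M) /\
   strongly_complete (add_scheme (G_diamond Var) (@Four_diamond Var))
     (fun M : gk_model R Var => gk_transitive M)) /\
  (strongly_complete (GS4_box Var)
     (fun M : gk_model R Var => gk_reflexive M /\ gk_transitive M) /\
   strongly_complete (GS4_diamond Var)
     (fun M : gk_model R Var => gk_reflexive M /\ gk_transitive M)).
Proof.
pose Refl W (S : W -> W -> R) := forall x, S x x = 1.
pose Trans W (S : W -> W -> R) := forall x y z, Num.min (S x y) (S y z) <= S x z.
have TboxS s p : @T_box nat p -> @T_box Var (fsubst s p) by case.
have TdiaS s p : @T_diamond nat p -> @T_diamond Var (fsubst s p) by case.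
have FboxS s p : @Four_box nat p -> @Four_box Var (fsubst s p) by case.
have FdiaS s p : @Four_diamond nat p -> @Four_diamond Var (fsubst s p) by case.
split; [split|split; split].
- apply: (@box_strongly_complete R Refl T_box) => [p ax M FM x _||w].
  + exact: T_box_valid.
  + exact: TboxS.
  (* The world quantified by the frame condition doubles as the base point inhabiting the model. *)
  + apply: (canonical_box_reflexive (w0 := w)) => p; by right.
- apply: (@diamond_strongly_complete R Refl T_diamond) => [p ax M FM x _||w].
  + exact: T_diamond_valid.
  + exact: TdiaS.
  + apply: (canonical_diamond_reflexive (w0 := w)) => p; by right.
- apply: (@box_strongly_complete R Trans Four_box) => [p ax M FM x _||w].
  + exact: Four_box_valid.
  + exact: FboxS.
  + apply: (canonical_box_transitive (w0 := w)) => p; by right.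
- apply: (@diamond_strongly_complete R Trans Four_diamond) => [p ax M FM x _||w].
  + exact: Four_diamond_valid.
  + exact: FdiaS.
  + apply: (canonical_diamond_transitive (w0 := w)) => p; by right.
- rewrite /GS4_box add_schemeA.
  apply: (@box_strongly_complete R (fun W S => Refl W S /\ Trans W S)
    (fun V => @T_box V `|` @Four_box V)).
  + move=> p [ax|ax] M [FR FT] x _; [exact: T_box_valid|exact: Four_box_valid].
  + by move=> s p [/(TboxS s)|/(FboxS s)]; [left|right].
  + split=> w; [apply: (canonical_box_reflexive (w0 := w))|
      apply: (canonical_box_transitive (w0 := w))] => p ax; right; by [left|right].
- rewrite /GS4_diamond add_schemeA.
  apply: (@diamond_strongly_complete R (fun W S => Refl W S /\ Trans W S)
    (fun V => @T_diamond V `|` @Four_diamond V)).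
  + move=> p [ax|ax] M [FR FT] x _;
      [exact: T_diamond_valid|exact: Four_diamond_valid].
  + by move=> s p [/(TdiaS s)|/(FdiaS s)]; [left|right].
  + split=> w; [apply: (canonical_diamond_reflexive (w0 := w))|
      apply: (canonical_diamond_transitive (w0 := w))] => p ax; right; by [left|right].
Qed.
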